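(* For any integer $\tau>0$ there is an Independent Cascade model $\mathcal{G}^\tau=(V,\mathcal{E})$ with a node $v\in V$ of maximum influence (i.e. $I^\tau(\{v\})=\max_{u\in V}I^\tau(\{u\})$) such that $$\operatorname{Var}[R^\tau(v)]\ \ge\ \frac{1}{12}\,\tau\, I^\tau(v)^2 .$$
   Context: An Independent Cascade (IC) model is specified by a finite directed graph $(V,\mathcal{E})$ and probabilities $p_e\in[0,1]$ for $e\in\mathcal{E}$: each edge $e$ is live independently with probability $p_e$, giving a random set $E\subset\mathcal{E}$ of live edges. For a node $v$, $R^\tau(v)$ is the random number of nodes reachable from $v$ (including $v$) in $(V,E)$ by directed paths of at most $\tau$ edges, and $I^\tau(v)=I^\tau(\{v\})=\mathbb{E}[R^\tau(v)]$. *)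

(* Defs.v *)
From mathcomp Require Import all_boot all_order all_algebra.
From mathcomp Require Import reals.

Set Implicit Arguments.
Unset Strict Implicit.
Unset Printing Implicit Defensive.

Import Order.TTheory GRing.Theory Num.Theory.
Local Open Scope ring_scope.

Record ic_model (R : realType) := ICModel {
  node : finType;
  edges : {set node * node};
  prob : node * node -> R;
  prob01 : forall e, e \in edges -> 0 <= prob e <= 1 }.

Section Cascade.
Context {R : realType}.
Variable G : ic_model R.
Local Notation V := (node G).

(* Product Bernoulli law: the sample space is [powerset (edges G)], and this
   is the probability that the set of live edges is exactly [E]. *)
Definition live_prob (E : {set V * V}) : R :=
  \prod_(e in edges G) (if e \in E then prob e else 1 - prob e).

Definition expectation (X : {set V * V} -> R) : R :=
  \sum_(E in powerset (edges G)) live_prob E * X E.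

Definition variance (X : {set V * V} -> R) : R :=
  expectation (fun E => (X E - expectation X) ^+ 2).

(* [s] lists the successive nodes of a directed walk leaving [v]; it has as
   many entries as the walk has edges, and s = [::] gives [v] itself. *)
Definition reachable (tau : nat) (v : V) (E : {set V * V}) : {set V} :=
  [set last v s | s : tau.-bseq V & path (fun x y => (x, y) \in E) v s].

Definition reach_count (tau : nat) (v : V) (E : {set V * V}) : R :=
  #|reachable tau v E|%:R.

Definition influence (tau : nat) (v : V) : R :=
  expectation (reach_count tau v).

(* Sanity check of [live_prob]: singletons [F] give the marginals [prob e],
   general [F] gives independence, and F = set0 gives total mass 1. *)
Lemma live_independent (F : {set V * V}) : F \subset edges G ->
  expectation (fun E => (F \subset E)%:R) = \prod_(e in F) prob e.
Proof.
move=> sFG.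
pose a e : R := if e \in edges G then prob e else 0.
pose b e : R :=
  if e \in edges G then (if e \in F then 0 else 1 - prob e) else 1.
have -> : \prod_(e in F) prob e = \prod_e (a e + b e).
  rewrite big_mkcond; apply: eq_bigr => e _; rewrite /a /b.
  case: ifP => eF; first by rewrite (subsetP sFG) ?addr0.
  by case: ifP => _; rewrite ?add0r // addrC subrK.
rewrite bigA_distr /expectation.
rewrite [RHS](bigID (mem (powerset (edges G)))) /= [X in _ = _ + X]big1 ?addr0.
  apply: eq_bigr => E; rewrite inE => sEG.
  case: (boolP (F \subset E)) => [sFE|/subsetPn[e eF eE]].
    rewrite mulr1 /live_prob big_mkcond; apply: eq_bigr => e _; rewrite /a /b.
    case: (boolP (e \in E)) => eE; first by rewrite (subsetP sEG).
    by case: ifP => // _; rewrite ifN //; apply: contra eE; apply: (subsetP sFE).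
  rewrite mulr0 (bigD1 e) //= (negbTE eE) /b (subsetP sFG) // eF.
  by rewrite mul0r.
move=> E; rewrite inE => /subsetPn[e eE eG].
by rewrite (bigD1 e) //= eE /a (negbTE eG) mul0r.
Qed.

End Cascade.

(* Main.v *)
(* Take the binary tree of depth [tau] directed away from its root, every edge
   being live with probability 1/2, i.e. a critical branching process. A node u
   reaches a descendant w with probability 2^-(|w| - |u|), so its influence is at
   most [tau + 1], with equality at the root. Two nodes v, w are both reached from
   the root with probability 2^-(|v| + |w| - |lcp v w|), where [lcp v w] is their
   last common ancestor; splitting the double sum at the first step away from the
   root shows that the variance at the root is tau (tau + 1) (2 tau + 1) / 12. *)
Require Import Defs.
From mathcomp Require Import all_boot all_order all_algebra.
From mathcomp Require Import ring lra reals.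

Import Order.TTheory GRing.Theory Num.Theory.
Local Open Scope ring_scope.

(** * Linearity of expectation and the second-moment formula for the variance *)

Section Expectation.
Context {R : realType} {G : ic_model R}.
Implicit Types X Y : {set node G * node G} -> R.

Lemma eq_expectation X Y :
  (forall E : {set node G * node G}, E \subset edges G -> X E = Y E) ->
  expectation X = expectation Y.
Proof. by move=> XY; apply: eq_bigr => E; rewrite inE => /XY ->. Qed.

Lemma expectation_sum (I : Type) (r : seq I) (P : pred I)
    (X_ : I -> {set node G * node G} -> R) :
  expectation (fun E : {set node G * node G} => \sum_(i <- r | P i) X_ i E) =
  \sum_(i <- r | P i) expectation (X_ i).
Proof.
by rewrite /expectation exchange_big; apply: eq_bigr => E _; rewrite mulr_sumr.
Qed.

Lemma varianceE X : variance X = expectation (fun E => X E ^+ 2) - expectation X ^+ 2.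
Proof.
have total : \sum_(E in powerset (edges G)) live_prob E = 1 :> R.
  have := live_independent (sub0set (edges G)); rewrite big_set0 => <-.
  by apply: eq_bigr => E _; rewrite sub0set mulr1.
rewrite /variance; set m := expectation X.
transitivity (\sum_(E in powerset (edges G)) (live_prob E * X E ^+ 2 +
    (- (m *+ 2) * (live_prob E * X E) + m ^+ 2 * live_prob E))).
  by apply: eq_bigr => E _; ring.
rewrite !big_split -!mulr_sumr total /= -/(expectation X) -/m.
by rewrite -/(expectation (fun E => X E ^+ 2)); ring.
Qed.

End Expectation.

(** * Prefixes and last common ancestors of words *)

Lemma prefix_rconsr (T : eqType) (s t : seq T) (b : T) :
  prefix s (rcons t b) = (s == rcons t b) || prefix s t.
Proof.
elim: t s => [|c t IH] [|a s]; rewrite ?prefix0s ?orbT //=.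
  by rewrite -/(prefix (a :: s) [:: b]) prefixs1 orbF.
by rewrite -/(prefix _ _) IH -andb_orr.
Qed.

Fixpoint lcp {T : eqType} (s t : seq T) : seq T :=
  match s, t with
  | a :: s', b :: t' => if a == b then a :: lcp s' t' else [::]
  | _, _ => [::]
  end.

(** Makes the intersection of two paths from the root the path to the last common ancestor. *)
Lemma prefix_lcp (T : eqType) (r s t : seq T) :
  prefix r (lcp s t) = prefix r s && prefix r t.
Proof.
elim: s r t => [|a s IH] [|c r] [|b t] //=; rewrite ?prefix0s ?prefixs0 ?andbF //.
case: eqP => [<-|/eqP ab] /=.
  by rewrite -!/(prefix _ _) IH; case: (c == a).
by case: eqP => // ->; rewrite (negbTE ab) andbF.
Qed.

(** * Reachability and moments in the critical binary tree *)

Section BinaryTree.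
Context {R : realType}.
Variable tau : nat.
Local Notation V := (tau.-bseq bool).

(** The word of a node records the turns taken from the root, so its ancestors are its prefixes. *)
Definition tree_edges : {set V * V} :=
  [set e | [exists b, val e.2 == rcons (val e.1) b]].

Fact half01 (e : V * V) : e \in tree_edges -> 0 <= (2^-1 : R) <= 1.
Proof. by move=> _; lra. Qed.

Definition tree : ic_model R := @ICModel R V tree_edges (fun=> 2^-1) half01.

(* An edge is identified with its head, so for a prefix u of w this is the set of
   edges on the path from u to w. The endpoints range over [seq bool] so that
   [[::]] denotes the root and segments to an [lcp] need no length bound. *)
Definition segment (u w : seq bool) : {set V * V} :=
  [set e in tree_edges | prefix (val e.2) w & ~~ prefix (val e.2) u].

Lemma segment_sub u w : segment u w \subset edges tree.
Proof. by apply/subsetP => e; rewrite inE => /andP[]. Qed.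

(** The only edge with head [z] comes from its parent [w], and [z] is too long to be a prefix of [u]
    or [w]. *)
Lemma segment_rcons (u w : V) b (z : V) : prefix u w -> val z = rcons w b ->
  segment u z = (w, z) |: segment u w.
Proof.
move=> uw zE; apply/setP => -[x y]; rewrite !inE /= zE prefix_rconsr.
rewrite xpair_eqE -[y == z]val_eqE zE /=.
case: (eqVneq (val y) (rcons w b)) => [yE|_] /=; last by rewrite andbF.
rewrite andbT yE; have -> : prefix (rcons w b) u = false.
  by apply/negP => /size_prefix; rewrite size_rcons ltnNge size_prefix.
have -> : prefix (rcons w b) w = false.
  by apply/negP => /size_prefix; rewrite size_rcons ltnn.
rewrite !andbF orbF andbT; apply/existsP/eqP => [[c]|->].
  by rewrite eqseq_rcons => /andP[/eqP/val_inj->].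
by exists b.
Qed.

Lemma segment_ge (u w : seq bool) : prefix w u -> segment u w = set0.
Proof.
move=> wu; apply/setP => e; rewrite !inE; apply/negbTE.
by rewrite !negb_and negbK -implybE; apply/orP; right; apply/implyP => /prefix_trans ->.
Qed.

(** Induction down the path from [u]: every prefix of a node is short enough to be a node itself. *)
Lemma descendant_ind (u : V) (P : V -> Prop) : P u ->
  (forall (w : V) b (z : V), prefix u w -> val z = rcons w b -> P w -> P z) ->
  forall w : V, prefix u w -> P w.
Proof.
move=> Pu Pstep w; move wE : (val w) => s; elim/last_ind: s w wE => [|s b IH] w wE.
  by rewrite prefixs0 => /eqP uE; have -> : w = u by apply: val_inj; rewrite wE.
rewrite prefix_rconsr => /orP[/eqP uE|us].
  by have -> : w = u by apply: val_inj; rewrite wE.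
have ls : (size s <= tau)%N.
  by apply: leq_trans (size_bseq w); rewrite wE size_rcons.
by apply: (Pstep (Bseq ls) b) => //; apply: IH.
Qed.

Lemma card_segment (u w : V) : prefix u w -> #|segment u w| = (size w - size u)%N.
Proof.
elim/(@descendant_ind u): w / => [|w b z uw zE IH].
  by rewrite segment_ge ?prefix_refl // cards0 subnn.
rewrite (segment_rcons u w b z) // cardsU1 IH zE size_rcons subSn ?size_prefix //.
rewrite inE /= zE [prefix (rcons w b) w](_ : _ = false) ?andbF //.
by apply/negP => /size_prefix; rewrite size_rcons ltnn.
Qed.

(** A tree has only one path from [u] to [w], so all of its edges must be live. *)
Lemma mem_reachable (E : {set V * V}) (u w : V) : E \subset tree_edges ->
  (w \in @reachable R tree tau u E) = prefix u w && (segment u w \subset E).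
Proof.
move=> sE; apply/imsetP/andP => [[s + ->]|[]].
  rewrite inE; case: s => s /= _; elim/last_ind: s => [|s z IH] /=.
    by rewrite prefix_refl segment_ge ?prefix_refl // sub0set.
  rewrite rcons_path last_rcons => /andP[/IH[us sub] zE].
  have := subsetP sE _ zE; rewrite inE => /existsP[b /= /eqP zb]; split.
    by rewrite zb prefix_rconsr us orbT.
  by rewrite (segment_rcons _ _ _ _ us zb) subUset sub1set zE.
(* Bounding the walk by [size w] makes the limit of [tau] edges automatic. *)
suff ex : prefix u w -> segment u w \subset E -> exists s : seq V,
    [/\ path (fun x y => (x, y) \in E) u s, w = last u s & (size s <= size w)%N].
  move=> uw /(ex uw)[s [ps ws ls]].
  by exists (Bseq (leq_trans ls (size_bseq w))) => //; rewrite inE.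
elim/(@descendant_ind u): w / => [_|w b z uw zE IH]; first by exists [::].
rewrite (segment_rcons _ _ _ _ uw zE) subUset sub1set => /andP[wz /IH[s [ps ws ls]]].
exists (rcons s z); rewrite rcons_path last_rcons ps -ws wz; split=> //.
by rewrite zE !size_rcons.
Qed.

Lemma reach_countE (E : {set V * V}) (u : V) : E \subset tree_edges ->
  @reach_count R tree tau u E =
  \sum_(w : V | prefix u w) (segment u w \subset E)%:R.
Proof.
move=> sE; rewrite /reach_count -sum1_card natr_sum.
rewrite (eq_bigl _ _ (fun w => mem_reachable E u w sE)) big_mkcondr /=.
by apply: eq_bigr => w _; case: ifP.
Qed.

Lemma subset_prob (F : {set V * V}) : F \subset tree_edges ->
  @expectation R tree (fun E => (F \subset E)%:R) = 2^-1 ^+ #|F|.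
Proof. by move=> sF; rewrite live_independent //= prodr_const. Qed.

Lemma influence_tree (u : V) : @influence R tree tau u =
  \sum_(w : V | prefix u w) 2^-1 ^+ (size w - size u).
Proof.
rewrite /influence (@eq_expectation R tree _ _ (fun E => reach_countE E u)).
rewrite expectation_sum; apply: eq_bigr => w uw.
by rewrite subset_prob ?card_segment //; apply: segment_sub.
Qed.

(** Inclusion-exclusion: the two root paths share exactly the path to [lcp v w]. *)
Lemma card_segmentU (v w : V) :
  (#|segment [::] v :|: segment [::] w| + size (lcp v w) = size v + size w)%N.
Proof.
have sz (x : V) : size x = #|segment [::] x|.
  by have := @card_segment [bseq] x (prefix0s x); rewrite subn0.
have ll : (size (lcp v w) <= tau)%N.
  apply: leq_trans (size_bseq v); apply: size_prefix.
  by have := prefix_refl (lcp v w); rewrite prefix_lcp => /andP[].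
rewrite -[lcp v w]/(val (Bseq ll)) !sz /= -[RHS]cardsUI; congr addn.
apply: eq_card => e; rewrite !inE prefix_lcp.
by case: [exists b, _]; case: (prefix _ [::]); rewrite /= ?andbF ?andbT.
Qed.

Lemma second_moment_tree :
  @expectation R tree (fun E => @reach_count R tree tau ([bseq] : V) E ^+ 2) =
  \sum_(v : V) \sum_(w : V) 2^-1 ^+ size v * 2^-1 ^+ size w * 2 ^+ size (lcp v w).
Proof.
transitivity (@expectation R tree (fun E => \sum_(v : V) \sum_(w : V)
    (segment [::] v :|: segment [::] w \subset E)%:R)).
  apply: eq_expectation => E sE; rewrite reach_countE // expr2.
  rewrite big_distrlr /=; apply: eq_big => [v|v _]; first by rewrite prefix0s.
  apply: eq_big => [w|w _]; first by rewrite prefix0s.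
  by rewrite subUset -natrM mulnb.
rewrite expectation_sum; apply: eq_bigr => v _.
rewrite expectation_sum; apply: eq_bigr => w _.
(* The exponent [size v + size w] counts the shared edges twice; the factor [2 ^+ size (lcp v w)]
   cancels the excess. *)
rewrite subset_prob ?subUset ?segment_sub // -exprD -card_segmentU exprD.
by rewrite -mulrA -exprMn mulVf ?pnatr_eq0 // expr1n mulr1.
Qed.

End BinaryTree.

(** * Binary words listed so that sums split at the first letter *)

Fixpoint words (n : nat) : seq (seq bool) :=
  [::] :: if n is m.+1 then map (cons true) (words m) ++ map (cons false) (words m)
          else [::].

Lemma mem_words n (x : seq bool) : (x \in words n) = (size x <= n)%N.
Proof.
elim: n x => [|n IH] [|b x] //=.
have cons_inj c : injective (cons c : seq bool -> seq bool) by move=> ? ? [].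
have cons_neq c : (b :: x \in map (cons c) (words n)) = (b == c) && (x \in words n).
  case: eqP => [->|bc]; first exact: mem_map.
  by apply: negbTE; apply/mapP => -[y _ [/bc]].
by rewrite inE mem_cat !cons_neq IH; case: b {cons_neq}; rewrite /= ?orbF.
Qed.

Lemma uniq_words n : uniq (words n).
Proof.
elim: n => [|n IH] //=; rewrite cat_uniq !map_inj_uniq ?IH //=; try by move=> ? ? [].
rewrite mem_cat andbT; apply/andP; split; first by apply/norP; split; apply/mapP => -[].
by apply/hasPn => _ /mapP[x _ ->]; apply/mapP => -[].
Qed.

(** Trades the finite type of nodes for a list that admits induction on the depth. *)
Lemma sum_bseq (R : nmodType) n (f : seq bool -> R) :
  \sum_(w : n.-bseq bool) f w = \sum_(x <- words n) f x.
Proof.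
rewrite -(big_map val xpredT f); apply/perm_big/uniq_perm => [||x].
- by rewrite map_inj_uniq ?index_enum_uniq //; apply: val_inj.
- exact: uniq_words.
rewrite mem_words; apply/mapP/idP => [[w _ ->]|lx]; first exact: size_bseq.
by exists (Bseq lx); rewrite ?mem_index_enum.
Qed.

Lemma sum_wordsS (R : nmodType) n (f : seq bool -> R) :
  \sum_(x <- words n.+1) f x =
  f [::] + (\sum_(x <- words n) f (true :: x) + \sum_(x <- words n) f (false :: x)).
Proof. by rewrite big_cons big_cat !big_map. Qed.

(** * Closed forms for the weighted sums *)

Section Sums.
Context {R : realType}.

Lemma sum_weight n : \sum_(x <- words n) 2^-1 ^+ size x = n.+1%:R :> R.
Proof.
elim: n => [|n IH]; first by rewrite big_seq1.
rewrite sum_wordsS /=; under eq_bigr do rewrite exprS.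
by rewrite -mulr_sumr IH -[in RHS]natr1; field.
Qed.

Lemma sum_weight_prefix n (u : seq bool) :
  \sum_(x <- words n | prefix u x) 2^-1 ^+ (size x - size u) <= n.+1%:R :> R.
Proof.
elim: n u => [|n IH] [|b u].
- by rewrite big_mkcond big_seq1.
- by rewrite big_mkcond big_seq1 /= ler01.
- by under eq_bigr do rewrite subn0; under eq_bigl do rewrite prefix0s; rewrite sum_weight.
rewrite big_mkcond sum_wordsS /= add0r.
apply: le_trans (_ : n.+1%:R <= _); last by rewrite ler_nat.
(* Only the subtree below [b] contributes, and the common first letter cancels in the exponent. *)
by case: b => /=; rewrite big1_eq ?addr0 ?add0r -big_mkcond; apply: IH.
Qed.

(** The second moment at the root: the first summand is the squared mean, the second the
    variance. *)
Lemma sum_lcp_weight n :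
  \sum_(x <- words n) \sum_(y <- words n)
     2^-1 ^+ size x * 2^-1 ^+ size y * 2 ^+ size (lcp x y) =
  n.+1%:R ^+ 2 + n%:R * n.+1%:R * (2 * n%:R + 1) / 12 :> R.
Proof.
elim: n => [|n IH]; first by rewrite !big_seq1 /=; field.
(* Equal first letters cost two factors 1/2 and gain a 2 from the longer [lcp]; distinct ones make
   [lcp] empty, so the double sum factors. *)
have S1 b c : \sum_(x <- words n) \sum_(y <- words n) 2^-1 ^+ size (b :: x) *
  2^-1 ^+ size (c :: y) * 2 ^+ size (lcp (b :: x) (c :: y)) =
  if b == c then 2^-1 *
   (n.+1%:R ^+ 2 + n%:R * n.+1%:R * (2 * n%:R + 1) / 12) else 4^-1 * n.+1%:R ^+ 2 :> R.
  case: eqP => [bc|/eqP/negbTE bc].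
    rewrite -IH mulr_sumr; apply: eq_bigr => x _; rewrite mulr_sumr; apply: eq_bigr => y _.
    by rewrite /= bc eqxx !exprS; field.
  rewrite -(sum_weight n) expr2 big_distrlr mulr_sumr; apply: eq_bigr => x _ /=.
  by rewrite mulr_sumr; apply: eq_bigr => y _; rewrite bc !exprS; field.
have Snil b : \sum_(x <- words n) 2^-1 ^+ size (b :: x) * 2^-1 ^+ size (@nil bool) *
    2 ^+ size (lcp (b :: x) [::]) = 2^-1 * n.+1%:R :> R.
  rewrite -(sum_weight n) mulr_sumr; apply: eq_bigr => x _.
  by rewrite /= !expr0 !mulr1 exprS.
have row b : \sum_(x <- words n) \sum_(y <- words n.+1) 2^-1 ^+ size (b :: x) *
    2^-1 ^+ size y * 2 ^+ size (lcp (b :: x) y) =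
    2^-1 * n.+1%:R + (2^-1 * (n.+1%:R ^+ 2 + n%:R * n.+1%:R * (2 * n%:R + 1) / 12) +
    4^-1 * n.+1%:R ^+ 2) :> R.
  under eq_bigr do rewrite sum_wordsS.
  by rewrite !big_split Snil !S1; case: b => //=; congr (_ + _); rewrite addrC.
rewrite sum_wordsS !row; under eq_bigr do rewrite /= expr0 mul1r mulr1.
by rewrite sum_weight -!natr1; field.
Qed.

End Sums.

Theorem theorem4p2 (R : realType) (tau : nat) (tau_gt0 : (0 < tau)%N) :
  exists (G : ic_model R) (v : node G),
    (forall u : node G, influence tau u <= influence tau v) /\
    1 / 12 * tau%:R * influence tau v ^+ 2 <= variance (reach_count tau v).
Proof.
have root : influence tau ([bseq] : node (tree tau)) = tau.+1%:R :> R.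
  rewrite influence_tree (eq_bigl xpredT) => [|w]; last by rewrite prefix0s.
  under eq_bigr do rewrite subn0.
  by rewrite (sum_bseq _ _ (fun x => 2^-1 ^+ size x)) sum_weight.
exists (tree tau), [bseq]; split=> [u|].
  rewrite root influence_tree big_mkcond.
  rewrite (sum_bseq _ _ (fun x => if prefix u x then 2^-1 ^+ (size x - size u) else 0)).
  by rewrite -big_mkcond sum_weight_prefix.
rewrite varianceE -/(influence _ _) root second_moment_tree.
rewrite (sum_bseq _ _ (fun x => \sum_(w : tau.-bseq bool)
  2^-1 ^+ size x * 2^-1 ^+ size w * 2 ^+ size (lcp x w))).
under eq_bigr => x _ do rewrite (sum_bseq _ _ (fun y =>
  2^-1 ^+ size x * 2^-1 ^+ size y * 2 ^+ size (lcp x y))).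
rewrite sum_lcp_weight -[tau.+1%:R]natr1.
move: (tau%:R : R) (ler0n R tau) => t t0; rewrite -subr_ge0.
(* The variance [t * (t + 1) * (2 * t + 1) / 12] exceeds [t * (t + 1) ^+ 2 / 12] by this amount. *)
rewrite [leRHS](_ : _ = t ^+ 2 * (t + 1) / 12); last by field.
by rewrite divr_ge0 ?mulr_ge0 ?exprn_ge0 ?addr_ge0 ?ler0n ?ler01.
Qed.
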